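(* For any $r\in(0,1)$ and $\varepsilon\in\left(0,\frac{1-r}{2}\right)$, there exist a constant $C_{\varepsilon,r}>0$ and $\nu_0>0$ such that for every $\nu>\nu_0$ $$t_{\mathrm{mix}}(\varepsilon,\nu)\ge C_{\varepsilon,r}\,\frac{f_\kappa(\nu)^{L_\kappa-1}}{L_\kappa}.$$
   Context: Let $K, L_1,\dots,L_K$ be positive integers and let $f_1,\dots,f_K:\mathbb{R}_+\to\mathbb{R}_+$ be monotone functions with $\lim_{\nu\to\infty} f_k(\nu)=\infty$ for every $k$. Put $\mathcal{B}_k=\{(k,l):1\le l\le L_k\}$ and $\Omega=\{0\}\cup\bigcup_{k=1}^K\mathcal{B}_k$. For each $\nu$, $\{X(t)\}_{t\ge 0}$ is the continuous-time Markov process on $\Omega$ with transition rates $q(0,(k,1))=L_k f_k(\nu)$, $q((k,1),0)=1$, $q((k,l),(k,l+1))=(L_k-l)f_k(\nu)$ for $1\le l\le L_k-1$, $q((k,l),(k,l-1))=l$ for $2\le l\le L_k$ (for $k=1,\dots,K$), all other off-diagonal rates being $0$. Its stationary distribution is $\pi(\nu)$ with $\pi_{(k,l)}(\nu)=\pi_0(\nu)\binom{L_k}{l}f_k(\nu)^l$ and $\pi_0(\nu)=\big(1+\sum_{k=1}^K\sum_{l=1}^{L_k}\binom{L_k}{l}f_k(\nu)^l\big)^{-1}$; write $\pi_S(\nu)=\sum_{x\in S}\pi_x(\nu)$ for $S\subseteq\Omega$. Let $d(t,\nu)=\max_{x\in\Omega}\|\mathbb{P}(X(t)\in\cdot\mid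 X(0)=x)-\pi(\nu)\|_{\mathrm{TV}}$ and $t_{\mathrm{mix}}(\varepsilon,\nu)=\inf\{t\ge 0: d(t,\nu)\le\varepsilon\}$. For $r\in(0,1)$ let $\tilde K(r)=\{k:\lim_{\nu\to\infty}\pi_{\mathcal{B}_k}(\nu)\le r\}$ (assumed non-empty), and let $\kappa\in\tilde K(r)$ be an index such that for every $j\in\tilde K(r)$, $\lim_{\nu\to\infty}\frac{L_j f_\kappa(\nu)^{L_\kappa-1}}{L_\kappa f_j(\nu)^{L_j-1}}\ge 1$ (equivalently, the branch $\mathcal{B}_\kappa$ has asymptotically the largest mean escape time among those in $\tilde K(r)$: with $T_{(k,1),0}(\nu)$ the hitting time of state $0$ starting from $(k,1)$, $\lim_{\nu\to\infty}\mathbb{E}T_{(\kappa,1),0}(\nu)/\mathbb{E}T_{(j,1),0}(\nu)\ge1$). The limits involved are assumed to exist (possibly equal to $\infty$ for the ratios). *)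

(* Defs.v *)
From HB Require Import structures.
From mathcomp Require Import all_boot all_order all_algebra.
From mathcomp Require Import all_classical all_reals all_analysis.
Set Implicit Arguments.
Unset Strict Implicit.
Unset Printing Implicit Defensive.
Import Order.TTheory GRing.Theory Num.Theory.
Import numFieldNormedType.Exports.
Local Open Scope classical_set_scope.
Local Open Scope ring_scope.

(* A time-homogeneous continuous-time Markov process on a finite state space S:
   [mp_law x] is the probability P( . | X(0) = x) and [mp_path t] is X(t), used
   only for t >= 0.  In [mp_markov] the finite list [past] prescribes states at
   times u <= s, and the conditional probability is multiplied out so that null
   events need no special treatment.  Only the off-diagonal values of the rate
   function q matter: P(X(h) = y | X(0) = x) = q x y * h + o(h) for y != x. *)
Record markov_process (R : realType) (S : finType) (q : S -> S -> R) :=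
  MarkovProcess {
  mp_display : measure_display;
  mp_space : measurableType mp_display;
  mp_law : S -> probability mp_space R;
  mp_path : R -> mp_space -> S;
  mp_measurable : forall (t : R) (y : S), 0 <= t ->
    measurable [set w | mp_path t w = y];
  mp_init : forall x : S, mp_law x [set w | mp_path 0 w = x] = 1%E;
  mp_markov : forall (x y z : S) (s h : R) (past : seq (R * S)),
    0 <= s -> 0 <= h ->
    (forall p : R * S, p \in past -> 0 <= p.1 <= s) ->
    let H := [set w | forall p : R * S, p \in past -> mp_path p.1 w = p.2] in
    mp_law x (H `&` [set w | mp_path s w = y]
                `&` [set w | mp_path (s + h) w = z]) =
    (mp_law x (H `&` [set w | mp_path s w = y]) *
     mp_law y [set w | mp_path h w = z])%E;
  mp_rates : forall x y : S, x != y ->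
    fine (mp_law x [set w | mp_path h w = y]) / h @[h --> 0^'+] --> q x y
}.
Arguments mp_law {R S q} _ _.
Arguments mp_path {R S q} _ _ _.

Definition prob_at (R : realType) (S : finType) (q : S -> S -> R)
    (X : markov_process q) (t : R) (x : S) (A : {set S}) : R :=
  fine (mp_law X x [set w | mp_path X t w \in A]).

(* Total variation distance sup_A |mu(A) - mu'(A)|, for set functions mu, mu';
   the default value 0 of the maximum is harmless, all terms being >= 0. *)
Definition tv_dist (R : realType) (S : finType) (mu mu' : {set S} -> R) : R :=
  \big[Num.max/(0 : R)]_(A : {set S}) `|mu A - mu' A|.

Definition set_mass (R : realType) (S : finType) (p : S -> R) (A : {set S}) : R :=
  \sum_(x in A) p x.

Definition mix_dist (R : realType) (S : finType) (q : S -> S -> R)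
    (X : markov_process q) (p : S -> R) (t : R) : R :=
  \big[Num.max/(0 : R)]_(x : S) tv_dist (prob_at X t x) (set_mass p).

(* The infimum is taken in the extended reals, with inf of the empty set +oo. *)
Definition t_mix (R : realType) (S : finType) (q : S -> S -> R)
    (X : markov_process q) (p : S -> R) (eps : R) : \bar R :=
  ereal_inf [set t%:E | t in [set t : R | 0 <= t /\ mix_dist X p t <= eps]].

(* [None] is the state 0 and [Some (Tagged _ i)], with i : 'I_(L k), is the
   state (k, i + 1). *)
Definition Omega (K : nat) (L : 'I_K -> nat) : finType :=
  option {k : 'I_K & 'I_(L k)}.

Definition level (K : nat) (L : 'I_K -> nat) (s : {k : 'I_K & 'I_(L k)}) : nat :=
  (tagged s).+1.

Definition branch (K : nat) (L : 'I_K -> nat) (k : 'I_K) : {set Omega L} :=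
  [set x : Omega L | if x is Some s then tag s == k else false].

(* In the next three definitions, a k stands for f_k(nu). *)
Definition rate (R : realType) (K : nat) (L : 'I_K -> nat) (a : 'I_K -> R)
    (x y : Omega L) : R :=
  match x, y with
  | None, None => 0
  | None, Some s =>
      if level s == 1%N then (L (tag s))%:R * a (tag s) else 0
  | Some s, None => if level s == 1%N then 1 else 0
  | Some s, Some s' =>
      if tag s != tag s' then 0
      else if level s' == (level s).+1 then
        (L (tag s) - level s)%:R * a (tag s)
      else if level s == (level s').+1 then (level s)%:R
      else 0
  end.

Definition pi0 (R : realType) (K : nat) (L : 'I_K -> nat) (a : 'I_K -> R) : R :=
  (1 + \sum_(k < K) \sum_(1 <= l < (L k).+1) 'C(L k, l)%:R * a k ^+ l)^-1.

Definition stat (R : realType) (K : nat) (L : 'I_K -> nat) (a : 'I_K -> R)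
    (x : Omega L) : R :=
  match x with
  | None => pi0 L a
  | Some s => pi0 L a * 'C(L (tag s), level s)%:R * a (tag s) ^+ level s
  end.

Definition branch_mass (R : realType) (K : nat) (L : 'I_K -> nat)
    (f : 'I_K -> R -> R) (k : 'I_K) (nu : R) : R :=
  set_mass (stat (fun i => f i nu)) (branch L k).

Definition Ktilde (R : realType) (K : nat) (L : 'I_K -> nat)
    (f : 'I_K -> R -> R) (r : R) : set 'I_K :=
  [set k | lim (branch_mass L f k nu @[nu --> +oo]) <= r].

Definition escape_ratio (R : realType) (K : nat) (L : 'I_K -> nat)
    (f : 'I_K -> R -> R) (i j : 'I_K) (nu : R) : R :=
  ((L j)%:R * f i nu ^+ (L i).-1) / ((L i)%:R * f j nu ^+ (L j).-1).

(* Main.v *)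
Require Import Defs.
From HB Require Import structures.
From mathcomp Require Import all_boot all_order all_algebra.
From mathcomp Require Import all_classical all_reals all_analysis.
From mathcomp Require Import ring lra.
Import Order.TTheory GRing.Theory Num.Theory.
Import numFieldNormedType.Exports.
Local Open Scope classical_set_scope.
Local Open Scope ring_scope.

(** Bottleneck argument on the branch B of index kappa.  Detailed balance makes
    pi stationary, so a chain started from pi conditioned on B has
    law at most pi / pi(B) at every time; hence it leaves B at a rate of at most
    pi_(kappa,1) / pi(B) <= L_kappa / f_kappa^(L_kappa - 1).  At a time t with
    d(t) <= eps, some starting point in B therefore gives
    1 - t L_kappa / f_kappa^(L_kappa - 1) <= pi(B) + eps,
    where pi(B) is eventually below r + (1 - r - eps) / 2.

    Both stationarity and the bound on the escape probability come from
    a function F of time that is subadditive by the Chapman-Kolmogorov equation: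
    F(t) <= n F(t / n), so F(t) <= t F'(0+). *)

(** * Limits of finite sums and subadditive functions of time *)

Lemma cvg_sum_fintype {R : realType} {T : Type} {F : set_system T}
    {FF : Filter F} {I : finType} {P : pred I} {f : I -> T -> R} {l : I -> R} :
  (forall i, P i -> f i x @[x --> F] --> l i) ->
  \sum_(i | P i) f i x @[x --> F] --> \sum_(i | P i) l i.
Proof. by move=> fl; apply: cvg_big => //; exact: add_continuous. Qed.

(** Cutting time [t] into [n.+1] equal steps gives [f t <= n.+1%:R * f (t / n.+1%:R)], and the
    quotient of [f] at a short step is close to [Q]. *)
Lemma subadditive_le_slope {R : realType} (f : R -> R) (Q t : R) :
  (forall s h, 0 < s -> 0 < h -> f (s + h) <= f s + f h) ->
  f h / h @[h --> 0^'+] --> Q -> 0 < t -> f t <= t * Q.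
Proof.
move=> fD fQ t0; apply/ler_addgt0Pr => e e0.
have fM n h : 0 < h -> f (n.+1%:R * h) <= n.+1%:R * f h.
  move=> h0; elim: n => [|n IHn]; first by rewrite !mul1r.
  rewrite -[n.+2]addn1 natrD !mulrDl !mul1r.
  apply: le_trans (fD _ _ _ _) _ => //; first by rewrite mulr_gt0.
  by rewrite lerD2r.
(* Over total time [t], a slack of [e / t] in the slope costs exactly [e]. *)
have Qlt : Q < Q + e / t by rewrite ltrDl divr_gt0.
have := cvgr_lt _ fQ _ Qlt.
rewrite near_withinE => -[d /= d0 dP].
have [n nP] : exists n, t / n.+1%:R < d.
  exists (Num.bound (t / d)).
  rewrite ltr_pdivrMr // mulrC -ltr_pdivrMr //.
  have := archi_boundP (ltW (divr_gt0 t0 d0)).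
  by move/lt_le_trans; apply; rewrite ler_nat.
set h := t / n.+1%:R in nP *.
have h0 : 0 < h by rewrite divr_gt0.
have /dP : ball 0 d h by rewrite /ball /= sub0r normrN gtr0_norm.
move=> /(_ h0) /= fhlt.
have -> : t = n.+1%:R * h by rewrite /h mulrC divfK // pnatr_eq0.
apply: le_trans (fM _ _ h0) _.
have -> : n.+1%:R * h * Q + e = n.+1%:R * (h * (Q + e / t)).
  by rewrite /h; field; rewrite gt_eqF //= (_ : (n%:R + 1) = n.+1%:R :> R) ?pnatr_eq0 // -natr1.
rewrite ler_pM2l // mulrC -ler_pdivrMr //; exact: ltW.
Qed.

(** * Transition probabilities of the process *)

Definition trans {R : realType} {S : finType} {q : S -> S -> R}
    (X : markov_process q) (t : R) (x y : S) : R :=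
  fine (mp_law X x [set w | mp_path X t w = y]).

(** The event [E] allows two uses: [setT] yields the law at time [t], and an event at a later time
    yields the Chapman-Kolmogorov sum. *)
Lemma measure_path_in {R : realType} {S : finType} {q : S -> S -> R}
    (X : markov_process q) (t : R) (x : S) (A : {set S})
    (E : set (mp_space X)) : 0 <= t -> measurable E ->
  fine (mp_law X x (E `&` [set w | mp_path X t w \in A])) =
  \sum_(y in A) fine (mp_law X x (E `&` [set w | mp_path X t w = y])).
Proof.
move=> t0 mE.
have mt y : measurable (E `&` [set w | mp_path X t w = y]).
  by apply: measurableI => //; exact: mp_measurable.
rewrite sum_fine; last by move=> y _; apply: fin_num_measure; exact: mt.
congr fine; rewrite -big_enum fsbig_seq ?enum_uniq //.
rewrite -measure_fin_bigcup //.
- congr (mp_law X x _); apply/seteqP; split => w /=.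
    by move=> [Ew wA]; exists (mp_path X t w) => //=; rewrite mem_enum.
  by move=> [y /= yA [Ew /= wy]]; rewrite wy -mem_enum.
- by move=> y z _ _ [w /= [[_ wy] [_ wz]]]; rewrite -wy -wz.
Qed.

Lemma prob_atE {R : realType} {S : finType} {q : S -> S -> R}
    (X : markov_process q) (t : R) (x : S) (A : {set S}) : 0 <= t ->
  prob_at X t x A = \sum_(y in A) trans X t x y.
Proof.
move=> t0; have := measure_path_in X t x A setT t0 measurableT.
by rewrite setTI /prob_at => ->; apply: eq_bigr => y _; rewrite setTI.
Qed.

Lemma trans_ge0 {R : realType} {S : finType} {q : S -> S -> R}
  (X : markov_process q) (t : R) (x y : S) : 0 <= trans X t x y.
Proof. exact/fine_ge0/measure_ge0. Qed.

Lemma trans_sum {R : realType} {S : finType} {q : S -> S -> R}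
  (X : markov_process q) (t : R) (x : S) : 0 <= t ->
  \sum_y trans X t x y = 1.
Proof.
move=> t0; have := prob_atE X t x [set: S]%SET t0.
rewrite /prob_at (_ : [set w | _] = setT) ?probability_setT; last first.
  by apply/seteqP; split => w //= _; rewrite inE.
by move=> /= ->; apply: eq_bigl => y; rewrite inE.
Qed.

Lemma chapman_kolmogorov {R : realType} {S : finType} {q : S -> S -> R}
  (X : markov_process q) (s h : R) (x z : S) : 0 <= s -> 0 <= h ->
  trans X (s + h) x z = \sum_y trans X s x y * trans X h y z.
Proof.
move=> s0 h0.
have mz : measurable [set w | mp_path X (s + h) w = z].
  by apply: mp_measurable; rewrite addr_ge0.
have := measure_path_in X s x [set: S]%SET _ s0 mz.
rewrite (_ : [set w | _ \in _] = setT) ?setIT; last first.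
  by apply/seteqP; split => w //= _; rewrite inE.
rewrite -/(trans _ _ _ _) => ->.
rewrite (eq_bigl predT) => [|y]; last by rewrite inE.
apply: eq_bigr => y _.
(* With an empty [past] the conditioning event is the whole space. *)
have := @mp_markov _ _ _ X x y z s h [::] s0 h0.
rewrite (_ : [set w | _] = setT) /=; last by apply/seteqP; split.
rewrite !setTI setIC => -> //.
by rewrite fineM //; apply: fin_num_measure; exact: mp_measurable.
Qed.

Lemma trans_id {R : realType} {S : finType} {q : S -> S -> R}
  (X : markov_process q) (x y : S) : x != y -> trans X 0 x y = 0.
Proof.
move=> xy; have := trans_sum X 0 x (lexx _).
rewrite (bigD1 x) //= {1}/trans mp_init /= -[RHS]addr0 => /addrI.
move/psumr_eq0P => -> //; first by move=> *; exact: trans_ge0.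
by rewrite eq_sym.
Qed.

(** * Reversible rates: stationarity and the bottleneck inequality *)

Lemma trans_slope {R : realType} {S : finType} {q : S -> S -> R}
  (X : markov_process q) (x y : S) : x != y ->
  trans X h x y / h @[h --> 0^'+] --> q x y.
Proof. exact: mp_rates. Qed.

(** The l1 distance [G h] between [p] and its image after time [h] is subadditive, and detailed
    balance makes its slope at 0 vanish; hence it is zero. *)
Lemma stationary_trans {R : realType} {S : finType} {q : S -> S -> R}
    (X : markov_process q) (p : S -> R)
    (pq : forall x y, x != y -> p x * q x y = p y * q y x) (t : R) (y : S) :
  0 <= t -> \sum_x p x * trans X t x y = p y.
Proof.
rewrite le0r => /predU1P[->|t0].
  rewrite (bigD1 y) //= big1 ?addr0 => [|x xy]; last by rewrite trans_id ?mulr0.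
  by rewrite /trans mp_init mulr1.
(* As a net flow into [z], [D] has no contribution from [x = z], so its slope involves off-diagonal
   rates only. *)
pose D h z := \sum_x (p x * trans X h x z - p z * trans X h z x).
have DE (h : R) z : 0 <= h -> D h z = \sum_x p x * trans X h x z - p z.
  by move=> h0; rewrite /D sumrB -mulr_sumr trans_sum // mulr1.
pose G h := \sum_z `|D h z|.
have GD (s h : R) : 0 < s -> 0 < h -> G (s + h) <= G s + G h.
  move=> s0 h0; rewrite /G.
  (* With P the transition matrix, p P(s+h) - p = (p P(s) - p) P(h) + (p P(h) - p), and P(h) does
     not increase the l1 norm. *)
  have DD z : D (s + h) z = \sum_x D s x * trans X h x z + D h z.
    rewrite !DE ?addr_ge0 ?ltW //.
    rewrite [X in _ = X + _](eq_bigr (fun x => (\sum_w p w * trans X s w x) * trans X h x z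
      - p x * trans X h x z)) => [|x _]; last by rewrite DE ?ltW // mulrBl.
    rewrite sumrB addrA subrK; congr (_ - _).
    under eq_bigr do rewrite (chapman_kolmogorov X _ _ _ _ (ltW s0) (ltW h0)) mulr_sumr.
    rewrite exchange_big; apply: eq_bigr => x _ /=.
    by rewrite mulr_suml; apply: eq_bigr => w _; rewrite mulrA.
  rewrite -big_split /=.
  apply: (@le_trans _ _ (\sum_z (\sum_x `|D s x| * trans X h x z + `|D h z|))).
    apply: ler_sum => z _; rewrite DD; apply: le_trans (ler_normD _ _) _.
    rewrite lerD2r; apply: le_trans (ler_norm_sum _ _ _) _.
    by apply: ler_sum => x _; rewrite normrM (ger0_norm (trans_ge0 _ _ _ _)).
  rewrite !big_split /= lerD2r exchange_big /=; apply: ler_sum => x _.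
  by rewrite -mulr_sumr trans_sum ?mulr1 // ltW.
have D0 : G h / h @[h --> 0^'+] --> (0 : R).
  have : \sum_z `|\sum_x (p x * (trans X h x z / h) - p z * (trans X h z x / h))|
      @[h --> 0^'+] --> \sum_(z : S) `|\sum_(x : S) (0 : R)|.
    apply: cvg_sum_fintype => z _; apply: cvg_norm.
    apply: cvg_sum_fintype => x _.
    have [->|xz] := eqVneq x z.
      by under eq_fun do rewrite subrr; exact: cvg_cst.
    have {2}<- : p x * q x z - p z * q z x = 0 by rewrite pq // subrr.
    by apply: cvgB; apply: (cvgM (cvg_cst _)); apply: trans_slope => //; rewrite eq_sym.
  rewrite big1 => [|z _]; last by rewrite big1 ?normr0.
  apply: cvg_trans; apply: near_eq_cvg.
  near=> h.
  have h0 : 0 < h by near: h; exact: nbhs_right_gt.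
  rewrite mulr_suml; apply: eq_bigr => z _.
  rewrite -[X in _ / X](gtr0_norm h0) -normf_div mulr_suml; congr `|_|.
  by apply: eq_bigr => x _; rewrite mulrBl !mulrA.
have {}D0 : G t = 0.
  apply: le_anti; rewrite {2}/G sumr_ge0 // andbT -(mulr0 t).
  exact: subadditive_le_slope GD D0 t0.
have /psumr_eq0P /(_ D0 y isT) /normr0_eq0 : forall z, true -> 0 <= `|D t z| by [].
by rewrite DE ?ltW // => /eqP; rewrite subr_eq0 => /eqP.
Unshelve. all: by end_near.
Qed.

(** The mass [F h] that starts in [A] and is outside at time [h] is subadditive: being outside at
    [s + h] means being outside at [s], or inside at [s] and outside after a further [h]. *)
Lemma bottleneck {R : realType} {S : finType} {q : S -> S -> R}
    (X : markov_process q) (p : S -> R) (p0 : forall x, 0 <= p x)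
    (pq : forall x y, x != y -> p x * q x y = p y * q y x)
    (A : {set S}) (t : R) : 0 <= t ->
  \sum_(x in A) \sum_(y in ~: A) p x * trans X t x y <=
  t * \sum_(x in A) \sum_(y in ~: A) p x * q x y.
Proof.
have xyA (x y : S) : x \in A -> y \in ~: A -> x != y.
  by move=> xA; apply: contraTneq => <-; rewrite inE xA.
rewrite le0r => /predU1P[->|t0].
  rewrite mul0r big1 // => x xA; rewrite big1 // => y yA.
  by rewrite trans_id ?mulr0 // xyA.
pose F h := \sum_(x in A) \sum_(y in ~: A) p x * trans X h x y.
apply: (subadditive_le_slope F) => // [s h s0 h0|]; last first.
  apply: (@cvg_trans _ ((\sum_(x in A) \sum_(y in ~: A)
      p x * (trans X h x y / h)) @[h --> 0^'+])).
    apply: near_eq_cvg; near=> h.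
    rewrite mulr_suml; apply: eq_bigr => x _; rewrite mulr_suml.
    by apply: eq_bigr => y _; rewrite mulrA.
  apply: cvg_sum_fintype => x xA; apply: cvg_sum_fintype => y yA.
  by apply: (cvgM (cvg_cst _)); apply: trans_slope; exact: xyA.
rewrite [leLHS](_ : _ = \sum_z \sum_(x in A) p x * trans X s x z *
    \sum_(y in ~: A) trans X h z y); last first.
  rewrite [RHS]exchange_big; apply: eq_bigr => x _.
  under [LHS]eq_bigr do rewrite (chapman_kolmogorov X _ _ _ _ (ltW s0) (ltW h0)) mulr_sumr.
  rewrite [LHS]exchange_big; apply: eq_bigr => z _ /=.
  by rewrite mulr_sumr; apply: eq_bigr => y _; rewrite mulrA.
(* The states [z] outside [A] give at most [F s], bounding the last factor by 1. *)
rewrite (bigID (mem A)) /= addrC; apply: lerD.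
  rewrite (eq_bigl (mem (~: A))) => [|z]; last by rewrite !inE.
  rewrite exchange_big /=.
  apply: ler_sum => x _; apply: ler_sum => z _.
  rewrite ler_piMr ?mulr_ge0 ?trans_ge0 //.
  rewrite -(trans_sum X h z (ltW h0)) [leRHS](bigID (mem (~: A))) /=.
  by rewrite lerDl sumr_ge0 // => *; exact: trans_ge0.
(* For [z] in [A], stationarity bounds the mass reaching [z] from [A] by [p z], which gives
   [F h]. *)
apply: ler_sum => z _; rewrite -mulr_suml -mulr_sumr ler_wpM2r //.
  by rewrite sumr_ge0 // => *; exact: trans_ge0.
rewrite -(stationary_trans X p pq _ _ (ltW s0)) [leRHS](bigID (mem A)) /=.
by rewrite lerDl sumr_ge0 // => *; rewrite mulr_ge0 ?trans_ge0.
Unshelve. all: by end_near.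
Qed.

Lemma mix_dist_ge {R : realType} {S : finType} {q : S -> S -> R}
    (X : markov_process q) (p : S -> R) (t : R) (x : S) (A : {set S}) :
  prob_at X t x A - set_mass p A <= mix_dist X p t.
Proof.
apply: le_trans (ler_norm _) _.
apply: (@le_trans _ _ (tv_dist (prob_at X t x) (set_mass p))).
  exact: (le_bigmax _ (fun A : {set S} => `|prob_at X t x A - set_mass p A|)).
exact: (le_bigmax _ (fun x => tv_dist (prob_at X t x) (set_mass p))).
Qed.

(** From each [x] in [A], the probability of being outside [A] at time [t] is at least the factor in
    parentheses; these bounds are averaged with weights [p]. *)
Lemma bottleneck_mix_dist {R : realType} {S : finType} {q : S -> S -> R}
    (X : markov_process q) (p : S -> R) (p0 : forall x, 0 <= p x)
    (pq : forall x y, x != y -> p x * q x y = p y * q y x)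
    (A : {set S}) (t : R) : 0 <= t ->
  set_mass p A * (1 - set_mass p A - mix_dist X p t) <=
  t * \sum_(x in A) \sum_(y in ~: A) p x * q x y.
Proof.
move=> t0; apply: le_trans (bottleneck X p p0 pq A t t0).
rewrite mulr_suml; apply: ler_sum => x _; rewrite -mulr_sumr ler_wpM2l //.
have := mix_dist_ge X p t x A; rewrite prob_atE //.
have := trans_sum X t x t0; rewrite (bigID (mem A)) /=.
rewrite [X in _ + X](eq_bigl (mem (~: A))) => [|y]; last by rewrite !inE.
lra.
Qed.

(** * The stationary distribution on the branches *)

Lemma pi0_gt0 {R : realType} {K : nat} (L : 'I_K -> nat) (a : 'I_K -> R) :
  (forall k, 0 <= a k) -> 0 < pi0 L a.
Proof.
move=> a0; rewrite /pi0 invr_gt0 ltr_wpDr // sumr_ge0 // => k _.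
by rewrite sumr_ge0 // => l _; rewrite mulr_ge0 ?exprn_ge0.
Qed.

Lemma stat_ge0 {R : realType} {K : nat} (L : 'I_K -> nat) (a : 'I_K -> R)
  (x : Omega L) : (forall k, 0 <= a k) -> 0 <= stat a x.
Proof.
move=> a0; have p0 := ltW (pi0_gt0 L a a0).
by case: x => [s|] //=; rewrite !mulr_ge0 // exprn_ge0.
Qed.

(** Across the edge from level l to l+1 this is (l+1) C(L, l+1) = (L-l) C(L, l), with l = 0 for the
    edge at state 0; non-adjacent states have rate 0 both ways. *)
Lemma stat_reversible {R : realType} {K : nat} (L : 'I_K -> nat)
    (a : 'I_K -> R) (x y : Omega L) :
  stat a x * rate a x y = stat a y * rate a y x.
Proof.
have step (k : 'I_K) (l : nat) :
    pi0 L a * 'C(L k, l)%:R * a k ^+ l * ((L k - l)%:R * a k) =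
    pi0 L a * 'C(L k, l.+1)%:R * a k ^+ l.+1 * l.+1%:R.
  have /(congr1 (fun n => n%:R : R)) := mul_bin_left (L k) l.
  rewrite !natrM exprS => e.
  transitivity (pi0 L a * a k ^+ l * a k * ((L k - l)%:R * 'C(L k, l)%:R)).
    by ring.
  by rewrite -e; ring.
case: x y => [[k i]|] [[k' j]|] //=.
- rewrite eq_sym; case: eqVneq => [e|_] /=; last by rewrite !mulr0.
  subst k'; rewrite /level /=.
  case: (eqVneq j.+1 i.+2) => [->|ji].
    by rewrite ltn_eqF // step.
  case: (eqVneq i.+1 j.+2) => [->|ij]; last by rewrite !mulr0.
  by rewrite -step.
- rewrite /level /=; case: eqP => [[->]|_]; last by rewrite !mulr0.
  by rewrite bin1 expr1 mulr1 mulrA.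
- rewrite /level /=; case: eqP => [[->]|_]; last by rewrite !mulr0.
  by rewrite bin1 expr1 mulr1 mulrA.
Qed.

Lemma mem_branch {K : nat} (L : 'I_K -> nat) (k : 'I_K) (x : Omega L) :
  (x \in branch L k) = if x is Some s then tag s == k else false.
Proof. by rewrite inE. Qed.

(** The only exit from a branch is the jump from (k,1) to 0, of rate 1, so the flow is the
    stationary mass of (k,1). *)
Lemma branch_outflow {R : realType} {K : nat} (L : 'I_K -> nat)
    (a : 'I_K -> R) (k : 'I_K) : (0 < L k)%N ->
  \sum_(x in branch L k) \sum_(y in ~: branch L k) stat a x * rate a x y =
  pi0 L a * (L k)%:R * a k.
Proof.
move=> Lk.
have exitE x : x \in branch L k ->
    \sum_(y in ~: branch L k) stat a x * rate a x y = stat a x * rate a x None.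
  rewrite mem_branch; case: x => [s|//] /eqP sk.
  rewrite (bigD1 None) /=; last by rewrite finset.in_setC mem_branch.
  rewrite big1 ?addr0 // => -[s'|]; last by rewrite eqxx andbF.
  rewrite finset.in_setC mem_branch -sk andbT eq_sym => ->.
  by rewrite mulr0.
rewrite (eq_bigr _ exitE).
rewrite (bigD1 (Some (Tagged (fun k => 'I_(L k)) (Ordinal Lk)))) /=; last first.
  by rewrite mem_branch /=.
rewrite big1 ?addr0 /level /= ?bin1 ?expr1 ?mulr1 //.
move=> [[k' i]|]; rewrite mem_branch //= => /andP[/eqP e ne]; subst k'.
rewrite /level /=; case: eqP => [[i0]|_]; last by rewrite mulr0.
by case/eqP: ne; congr (Some (Tagged _ _)); apply: val_inj.
Qed.

(** Only the top state (k, L_k) is kept; its binomial coefficient is 1. *)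
Lemma branch_mass_ge {R : realType} {K : nat} (L : 'I_K -> nat)
    (a : 'I_K -> R) (k : 'I_K) : (forall k, 0 <= a k) -> (0 < L k)%N ->
  pi0 L a * a k ^+ L k <= set_mass (stat a) (branch L k).
Proof.
move=> a0 Lk; have Lk1 : ((L k).-1 < L k)%N by rewrite prednK.
rewrite /set_mass (bigD1 (Some (Tagged (fun k => 'I_(L k)) (Ordinal Lk1)))) /=.
  rewrite /level /= prednK // binn mulr1 lerDl.
  by rewrite sumr_ge0 // => *; exact: stat_ge0.
by rewrite mem_branch /=.
Qed.

Theorem proposition8p1 (R : realType) (r eps : R)
    (hr : 0 < r < 1) (heps : 0 < eps < (1 - r) / 2) :
  exists C : R, 0 < C /\
  forall (K : nat) (L : 'I_K -> nat) (f : 'I_K -> R -> R) (kappa : 'I_K),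
    (0 < K)%N ->
    (forall k, (0 < L k)%N) ->
    (forall k (nu : R), 0 <= nu -> 0 <= f k nu) ->
    (forall k (x y : R), 0 <= x -> x <= y -> f k x <= f k y) ->
    (forall k, f k nu @[nu --> +oo] --> +oo) ->
    (forall k, cvg (branch_mass L f k nu @[nu --> +oo])) ->
    Ktilde L f r kappa ->
    (forall j, Ktilde L f r j ->
       cvg ((escape_ratio L f kappa j nu)%:E @[nu --> +oo%R]) /\
       (1 <= lim ((escape_ratio L f kappa j nu)%:E @[nu --> +oo%R]))%E) ->
    exists nu0 : R, 0 < nu0 /\
    forall nu : R, nu0 < nu ->
    forall X : markov_process (rate (L := L) (fun k => f k nu)),
      ((C * (f kappa nu ^+ (L kappa).-1 / (L kappa)%:R))%:E
         <= t_mix X (stat (L := L) (fun k => f k nu)) eps)%E.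
Proof.
have C0 : 0 < (1 - r - eps) / 2 by lra.
(* Half of the gap between [r + eps] and 1; the other half absorbs the excess of the branch mass
   over [r] at finite [nu]. *)
exists ((1 - r - eps) / 2); split => //.
move=> K L f kappa _ L0 f0 _ foo cvgB Kr _.
have : \forall nu \near +oo, 0 < nu /\ 0 < f kappa nu /\
    branch_mass L f kappa nu < r + (1 - r - eps) / 2.
  near=> nu; split; first by near: nu; exact: nbhs_pinfty_gt.
  split; near: nu.
    by move/cvgryPgt : (foo kappa); apply.
  apply: (cvgr_lt _ (cvgB kappa)); apply: (le_lt_trans Kr).
  by rewrite ltrDl.
move=> [M [_ HM]].
exists (Num.max M 1); split; first by rewrite lt_max ltr01 orbT.
move=> nu; rewrite gt_max => /andP[/HM [nu0 [fpos mlt]] _ X].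
pose a k := f k nu; have a0 k : 0 <= a k by rewrite f0 // ltW.
(* It suffices to bound every [t] with [mix_dist] at most [eps]. *)
apply: le_ereal_inf_tmp => _ [t [t0 mixt] <-]; rewrite lee_fin.
have := bottleneck_mix_dist X (stat a) (fun x => stat_ge0 L a x a0)
  (fun x y _ => stat_reversible L a x y) (branch L kappa) t t0.
rewrite branch_outflow //.
set m := set_mass _ _ => flow.
have {}flow : pi0 L a * a kappa ^+ L kappa * ((1 - r - eps) / 2) <=
    t * (pi0 L a * (L kappa)%:R * a kappa).
  apply: le_trans flow; apply: ler_pM.
  - by rewrite mulr_ge0 ?exprn_ge0 // ltW // pi0_gt0.
  - exact: ltW.
  - exact: branch_mass_ge.
  - move: mlt mixt; rewrite /branch_mass -/a -/m; lra.
(* Cancelling this common factor leaves the power [(L kappa).-1] on the left and [t * (L kappa)%:R]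
   on the right. *)
have pa0 : 0 < pi0 L a * a kappa by rewrite mulr_gt0 // pi0_gt0.
have Lpos : 0 < (L kappa)%:R :> R by rewrite ltr0n.
move: flow; rewrite -{1}(prednK (L0 kappa)) exprS => flow.
rewrite mulrA ler_pdivrMr //.
rewrite -(ler_pM2l pa0); move: flow; rewrite -/(a kappa).
by congr (is_true (_ <= _)); ring.
Unshelve. all: by end_near.
Qed.
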